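(* Let $t>1$, $f=t-1$, and let $d$ be an integer with $0\le d\le t$, $d\ne t-1$. Then there is no discreet strategy for the parameters $(t,f,d)$.
   Context: There are $t$ distinguishable coins, identified with a set $T$ with $|T|=t$. All real coins weigh the same, all fake coins weigh the same, and a fake coin is lighter than a real one. Exactly $f$ coins are fake; the lawyer knows the true set $F\subset T$ of fake coins, $|F|=f$. The judge only knows in advance that the number of fake coins is either $f$ or $d$ ($d\neq f$, $0\le d\le t$). A weighing places $n\ge 1$ coins on the left pan and $n$ other coins on the right pan of a balance scale; its outcome is one of ''balanced'', ''left pan lighter'', ''right pan lighter'' (the pan with more fake coins is lighter; the pans balance if they contain equally many fake coins). For a finite sequence of weighings performed with true fake set $F$, a set $S\subseteq T$ is consistent if, were $S$ the set of fake coins, every weighing would have the same outcome as it has for $F$. A strategy for $(t,f,d)$ is a choice of $F$ with $|F|=f$ and a finite sequence of weighings that proves to the judge that there are exactly $f$ fake coins, i.e. no set $S$ with $|S|=d$ is consistent. It is discreet if no information about any particular coin is revealed: for every coin $c\in T$ there is a consistent set $S$ with $|S|=f$ and $c\in S$, and also a consistent set $S'$ with $|S'|=f$ and $c\notin S'$. *)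

(* Defs.v *)
From mathcomp Require Import all_boot.
Set Implicit Arguments.
Unset Strict Implicit.
Unset Printing Implicit Defensive.

Record weighing (T : finType) := Weighing {
  left_pan : {set T};
  right_pan : {set T};
  left_pan_gt0 : 0 < #|left_pan|;
  eq_card_pans : #|left_pan| = #|right_pan|;
  disjoint_pans : [disjoint left_pan & right_pan]
}.

Inductive outcome := Balanced | LeftLighter | RightLighter.

(* Fake coins are lighter and both pans hold equally many coins, so the pan
   with more fake coins is the lighter one. *)
Definition weigh (T : finType) (S : {set T}) (w : weighing T) : outcome :=
  let l := #|left_pan w :&: S| in
  let r := #|right_pan w :&: S| in
  if l == r then Balanced else if r < l then LeftLighter else RightLighter.

Definition consistent (T : finType) (F : {set T}) (ws : seq (weighing T))
    (S : {set T}) : Prop :=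
  [seq weigh S w | w <- ws] = [seq weigh F w | w <- ws].

(* The lawyer knows F, hence every outcome in advance: a fixed sequence of
   weighings loses no generality over an adaptive one. *)
Definition strategy (T : finType) (f d : nat) (F : {set T})
    (ws : seq (weighing T)) : Prop :=
  #|F| = f /\ ~ (exists S : {set T}, #|S| = d /\ consistent F ws S).

Definition discreet (T : finType) (f : nat) (F : {set T})
    (ws : seq (weighing T)) : Prop :=
  forall c : T,
    (exists S : {set T}, [/\ #|S| = f, consistent F ws S & c \in S]) /\
    (exists S : {set T}, [/\ #|S| = f, consistent F ws S & c \notin S]).

(* Main.v *)
Require Import Defs.
From mathcomp Require Import all_boot.

(** With [t - 1] fake coins a candidate set of fake coins is determined by its
    single real coin.  Since discreetness demands, for every coin [c], a
    consistent candidate that avoids [c], the complement of every single coin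
    must be consistent ([discreet_setC1_consistent]).

    No weighing survives this: if the real coin lies on the left pan, the right
    pan is lighter, and if it lies on the right pan, the left pan is lighter
    ([weigh_setC1_left], [weigh_setC1_right]); both pans are nonempty, so the
    two candidates whose real coin is on the left, respectively on the right,
    are told apart by the weighing.  A discreet sequence of weighings is
    therefore empty, and an empty sequence rules out nothing, in particular no
    set of [d] coins. *)

Lemma cardsI_setC1 {T : finType} (A : {set T}) (c : T) :
  #|A :&: ~: [set c]| = #|A| - (c \in A).
Proof. by rewrite -setDE (cardsD1 c A) addKn. Qed.

Lemma right_pan_gt0 {T : finType} (w : weighing T) : 0 < #|right_pan w|.
Proof. by rewrite -eq_card_pans left_pan_gt0. Qed.

Lemma weigh_setC1_left {T : finType} (w : weighing T) (c : T) :
  c \in left_pan w -> weigh (~: [set c]) w = RightLighter.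
Proof.
move=> cL; have cR := disjointFr (disjoint_pans w) cL.
rewrite /weigh !cardsI_setC1 cL cR -eq_card_pans subn0 subn1.
by case: #|left_pan w| (left_pan_gt0 w) => // n _; rewrite (ltn_eqF (ltnSn n)) ltnNge leqnSn.
Qed.

Lemma weigh_setC1_right {T : finType} (w : weighing T) (c : T) :
  c \in right_pan w -> weigh (~: [set c]) w = LeftLighter.
Proof.
move=> cR; have cL := disjointFl (disjoint_pans w) cR.
rewrite /weigh !cardsI_setC1 cL cR eq_card_pans subn0 subn1.
by case: #|right_pan w| (right_pan_gt0 w) => // n _; rewrite (gtn_eqF (ltnSn n)) ltnSn.
Qed.

(** A set of [#|T| - 1] coins that avoids [c] can only be the complement of
    [c], so the consistent set that discreetness provides is that one. *)
Lemma discreet_setC1_consistent {T : finType} (F : {set T})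
    (ws : seq (weighing T)) (c : T) :
  discreet (#|T| - 1) F ws -> consistent F ws (~: [set c]).
Proof.
move=> /(_ c) [_ [S [cardS consS cNS]]].
suff <- : S = ~: [set c] by [].
by apply/eqP; rewrite eqEcard subsetC sub1set inE cNS cardsC1 cardS subn1 /=.
Qed.

Lemma discreet_nil {T : finType} (F : {set T}) (ws : seq (weighing T)) :
  discreet (#|T| - 1) F ws -> ws = [::].
Proof.
case: ws => // w ws disc.
have /card_gt0P [a aL] := left_pan_gt0 w.
have /card_gt0P [b bR] := right_pan_gt0 w.
have [wa _] := discreet_setC1_consistent F (w :: ws) a disc.
have [wb _] := discreet_setC1_consistent F (w :: ws) b disc.
by move: wa; rewrite -wb (weigh_setC1_left w a aL) (weigh_setC1_right w b bR).
Qed.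

Lemma exists_set_card {T : finType} (d : nat) :
  d <= #|T| -> exists S : {set T}, #|S| = d.
Proof.
rewrite -bin_gt0 -card_draws => /card_gt0P [S].
by rewrite inE => /eqP cardS; exists S.
Qed.

Theorem lemma2 (t d : nat) (T : finType) (cardT : #|T| = t)
    (t_gt1 : 1 < t) (d_le_t : d <= t) (d_neq_f : d <> t - 1) :
  ~ (exists (F : {set T}) (ws : seq (weighing T)),
       strategy (t - 1) d F ws /\ discreet (t - 1) F ws).
Proof.
move=> [F [ws [[_ excluded] disc]]].
move: disc d_le_t; rewrite -cardT => /discreet_nil ws_nil /exists_set_card [S cardS].
by apply: excluded; exists S; rewrite ws_nil.
Qed.
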